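(* Let $\mathbb{K}$ be a field and let $R=\mathbb{K}[x_1,\dots,x_k]$ be graded by $W=[d_1,\dots,d_k]$, where the $d_i$ are positive integers with $\gcd(d_1,\dots,d_k)=1$. Let $d=\operatorname{lcm}(d_1,\dots,d_k)$, let $P_R^W=\{P_0,\dots,P_{d-1}\}$ be the Hilbert quasi-polynomial of $(R,W)$, and let $$\delta=\max\{|I| \mid I\subseteq\{1,\dots,k\},\ \gcd(d_i)_{i\in I}\neq 1\}.$$ If $\delta\le k-2$, then for all $i=0,\dots,d-1$ the coefficient $c_{k-2}$ of $x^{k-2}$ in $P_i$ is $$c_{k-2}=\frac{\sum_{i=1}^k d_i}{2\cdot(k-2)!\cdot\prod_{i=1}^k d_i}.$$
   Context: The grading by $W$ is $\deg(x_1^{\alpha_1}\cdots x_k^{\alpha_k})=d_1\alpha_1+\cdots+d_k\alpha_k$, and the Hilbert function is $H_R^W(n)=\dim_{\mathbb{K}}(R_n)$. The Hilbert quasi-polynomial of $(R,W)$ is the unique $d$-tuple $\{P_0,\dots,P_{d-1}\}$ of polynomials in $\mathbb{Q}[x]$ such that for all sufficiently large $n$, $H_R^W(n)=P_i(n)$ where $i\in\{0,\dots,d-1\}$, $i\equiv n\bmod d$. Convention: $\delta=0$ if all $d_i=1$. *)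

(* Defs.v *)
From HB Require Import structures.
From mathcomp Require Import all_boot all_order all_algebra.
From mathcomp Require Export mpoly.

Set Implicit Arguments.
Unset Strict Implicit.
Unset Printing Implicit Defensive.

Import GRing.Theory.
Local Open Scope ring_scope.

Definition wdeg (k : nat) (d : 'I_k -> nat) (m : 'X_{1..k}) : nat :=
  (\sum_(i < k) d i * m i)%N.

Section WeightedDegree.
Context (k : nat) (d : 'I_k -> nat).

Lemma wdeg0 : wdeg d 0%MM = 0%N.
Proof. by rewrite /wdeg big1 // => i _; rewrite mnm0E muln0. Qed.

Lemma wdegD : {morph wdeg d : m1 m2 / (m1 + m2)%MM >-> (m1 + m2)%N}.
Proof.
move=> m1 m2; rewrite /wdeg -big_split /=; apply: eq_bigr => i _.
by rewrite mnmDE mulnDr.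
Qed.

HB.instance Definition _ := isMeasure.Build k (wdeg d) wdeg0 wdegD.

Lemma mdeg_le_wdeg (m : 'X_{1..k}) :
  (forall i, (0 < d i)%N) -> (mdeg m <= wdeg d m)%N.
Proof.
move=> d_gt0; rewrite mdegE /wdeg; apply: leq_sum => i _.
exact: leq_pmull.
Qed.

End WeightedDegree.

(* The graded piece R_n of R = K[x_1, ..., x_k]. Positivity of the weights is
   a parameter because R_n may otherwise be infinite-dimensional, so that the
   vectType instance below would not exist. *)
Section GradedPiece.
Context (K : fieldType) (k : nat) (d : 'I_k -> nat).
Context (d_gt0 : forall i, (0 < d i)%N) (n : nat).

Record graded_piece (pos : forall i, (0 < d i)%N) := GradedPiece {
  mpoly_of_graded_piece :> {mpoly K[k]};
  _ : mpoly_of_graded_piece \is n.-homog for (wdeg d) }.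

Local Notation Rn := (graded_piece d_gt0).

HB.instance Definition _ := [isSub for @mpoly_of_graded_piece d_gt0].
HB.instance Definition _ := [Choice of Rn by <:].
HB.instance Definition _ := [SubChoice_isSubLmodule of Rn by <:].

Let B : {set 'X_{1..k < n.+1}} := [set m | wdeg d (bmnm m) == n].

Lemma graded_piece_vecaxiom : Vector.axiom #|B| Rn.
Proof.
pose M (i : 'I_#|B|) : 'X_{1..k} := bmnm (enum_val i).
have M_inj : injective M by move=> i j /val_inj /enum_val_inj.
have degM i : wdeg d (M i) = n.
  by have := enum_valP i; rewrite inE => /eqP.
pose g (r : 'rV[K]_#|B|) : {mpoly K[k]} := \sum_i r 0 i *: 'X_[M i].
have dhg r : g r \is n.-homog for (wdeg d).
  rewrite rpred_sum // => i _; apply: rpredZ.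
  by rewrite dhomogX /= degM.
have gM r i : (g r)@_(M i) = r 0 i.
  rewrite /g raddf_sum /= (bigD1 i) //= mcoeffZ mcoeffX eqxx mulr1.
  rewrite big1 ?addr0 // => j ne; rewrite mcoeffZ mcoeffX.
  by rewrite (inj_eq M_inj) (negbTE ne) mulr0.
exists (fun p : Rn => \row_i (mpoly_of_graded_piece p)@_(M i)).
  by move=> c p q; apply/rowP=> i; rewrite !mxE /= mcoeffD mcoeffZ.
exists (fun r => GradedPiece d_gt0 (dhg r)); last first.
  by move=> r; apply/rowP=> i; rewrite mxE /= gM.
case=> p hp; apply/val_inj/mpolyP => m /=.
case: (wdeg d m =P n) => [degm|/eqP ne]; last first.
  by rewrite (dhomog_nemf_coeff (dhg _) ne) (dhomog_nemf_coeff hp ne).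
have ltm : (mdeg m < n.+1)%N by rewrite ltnS -degm mdeg_le_wdeg.
have mB : BMultinom ltm \in B by rewrite inE /= degm.
have -> : m = M (enum_rank_in mB (BMultinom ltm)).
  by rewrite /M enum_rankK_in.
by rewrite gM mxE.
Qed.

HB.instance Definition _ :=
  Lmodule_hasFinDim.Build K Rn graded_piece_vecaxiom.

Definition hilbert_function : nat := \dim {: Rn}.

End GradedPiece.

Definition weights_gcd (k : nat) (d : 'I_k -> nat) (I : {set 'I_k}) : nat :=
  \big[gcdn/0%N]_(i in I) d i.

Definition weights_lcm (k : nat) (d : 'I_k -> nat) : nat :=
  \big[lcmn/1%N]_(i < k) d i.

(* The empty subset has gcd 0 != 1 and cardinality 0, so the maximum is over a
   nonempty family, and it is 0 when all the weights are 1. *)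
Definition weights_delta (k : nat) (d : 'I_k -> nat) : nat :=
  \max_(I : {set 'I_k} | weights_gcd d I != 1%N) #|I|.

Definition is_hilbert_quasi_polynomial (K : fieldType) (k : nat)
    (d : 'I_k -> nat) (d_gt0 : forall i, (0 < d i)%N)
    (P : (weights_lcm d).-tuple {poly rat}) : Prop :=
  exists N : nat, forall n : nat, (N <= n)%N ->
    forall i : 'I_(weights_lcm d), (i = n %[mod weights_lcm d])%N ->
      (hilbert_function K d_gt0 n)%:R = (tnth P i).[n%:R].

(* Main.v *)
Require Import Defs.
From mathcomp Require Import all_boot all_order all_algebra.
From mathcomp Require Import ring.
Set Implicit Arguments.
Unset Strict Implicit.
Unset Printing Implicit Defensive.
Import GRing.Theory.
Local Open Scope ring_scope.

(** Let D be the lcm of the weights. Dividing [d_j * m_j] by D for every j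
    writes an exponent m uniquely as a residue vector x, with [x_j < D] and
    [d_j | x_j], plus a vector of quotients. Hence, for large n,
    [H(n) = \sum_x 'C(k - 1 + (n - \sum_j x_j) / D, k - 1)],
    the sum being over the residue vectors x of the finite box [weight_box]
    whose sum is congruent to n modulo D ([hilbert_function_box]). Each binomial
    coefficient is a product of k - 1 monic linear factors in n, divided by
    [D ^ (k - 1) * (k - 1)!]. So the coefficient of degree k - 2 in P_i only
    involves the number of x in the box whose sum is congruent to i, and the
    sums of the coordinates x_j over those x.

    Both quantities are independent of i, by [box_equidistribution]. Adding
    d_l to the coordinate x_l modulo D permutes the box and moves the class of
    the sum by d_l; a sum over a class is therefore d_l-periodic in the class
    as soon as its summand ignores x_l, and it is constant once the available
    d_l have gcd 1. For the number of vectors all the weights are available.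
    For the sum of the x_j all the weights but d_j are, and those have gcd 1
    because delta is at most k - 2. Each quantity is thus 1 / D times its total
    over the box, and since the box is a product of the sets of multiples of
    the d_j below D, those totals are explicit: x_j has mean [(D - d_j) / 2]
    and the box has [\prod_j (D / d_j)] elements. *)

(** * Counting monomials by residue vectors *)

(** The modulus D is written L.+1 so that 'I_L.+1 is the group Z/D. *)
Definition weight_box (k L : nat) (d : 'I_k -> nat) :
    {set {ffun 'I_k -> 'I_L.+1}} :=
  [set x : {ffun 'I_k -> 'I_L.+1} | [forall j, d j %| x j]%N].

Lemma hilbert_functionE (K : fieldType) (k : nat) (d : 'I_k -> nat)
    (d_gt0 : forall j, (0 < d j)%N) (n : nat) :
  hilbert_function K d_gt0 n =
    #|[set m : 'X_{1..k < n.+1} | wdeg d (bmnm m) == n]|.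
Proof. by rewrite /hilbert_function dimvf. Qed.

Lemma sum_ord_le (k L : nat) (x : {ffun 'I_k -> 'I_L.+1}) :
  (\sum_j x j <= k * L.+1)%N.
Proof.
rewrite -[k in leqRHS]card_ord -sum_nat_const.
by apply: leq_sum => j _; apply: ltnW.
Qed.

(** The monomials m of weight n with [d_j * m_j] congruent to x_j correspond,
    through the quotients of the [d_j * m_j] by D, to the ordered partitions of
    [(n - \sum_j x_j) / D] into p + 1 parts, which are counted by a binomial
    coefficient. The bound on n makes the natural subtraction exact. *)
Lemma hilbert_function_box (K : fieldType) (p L : nat) (d : 'I_p.+1 -> nat)
    (d_gt0 : forall j, (0 < d j)%N) (d_dvd : forall j, (d j %| L.+1)%N)
    (n : nat) :
  (p.+1 * L.+1 <= n)%N ->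
  hilbert_function K d_gt0 n =
    (\sum_(x in weight_box L d | n == \sum_j x j %[mod L.+1])
      'C(p + (n - \sum_j x j) %/ L.+1, p))%N.
Proof.
move=> n_large; rewrite hilbert_functionE.
pose res (m : 'X_{1..p.+1 < n.+1}) : {ffun 'I_p.+1 -> 'I_L.+1} :=
  [ffun j => inord (d j * m j %% L.+1)%N].
have resE m j : res m j = (d j * m j %% L.+1)%N :> nat.
  by rewrite ffunE inordK // ltn_mod.
rewrite -sum1_card.
rewrite (partition_big res
  [pred x in weight_box L d | n == \sum_j x j %[mod L.+1]]%N) /=; last first.
  move=> m; rewrite !inE => /eqP degm; apply/andP; split.
    by apply/forallP=> j; rewrite resE /dvdn modn_dvdm // modnMr.
  have -> : (n = \sum_j d j * m j)%N by rewrite -[LHS]degm.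
  rewrite -modn_summ; apply/eqP; congr modn.
  by apply: eq_bigr => j _; rewrite resE.
apply: eq_bigr => x /andP[]; rewrite inE => /forallP x_dvd n_x.
have x_le : (\sum_j x j <= n)%N.
  exact: leq_trans (sum_ord_le x) n_large.
have nE : n = (\sum_j x j + L.+1 * ((n - \sum_j x j) %/ L.+1))%N.
  by rewrite mulnC divnK ?subnKC // -eqn_mod_dvd // eq_sym.
set q := ((n - \sum_j x j) %/ L.+1)%N in nE *.
rewrite -(card_ord_partitions p q).
pose fibre := [set m : 'X_{1..p.+1 < n.+1} | wdeg d (bmnm m) == n & res m == x].
rewrite sum1_card (_ : #|_| = #|fibre|); last first.
  by apply: eq_card => m; rewrite inE unfold_in inE.
pose quo (m : 'X_{1..p.+1 < n.+1}) : p.+1.-tuple 'I_q.+1 :=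
  [tuple inord (d j * m j %/ L.+1)%N | j < p.+1].
have dmE (m : 'X_{1..p.+1 < n.+1}) j : res m = x ->
    (d j * m j = x j + L.+1 * (d j * m j %/ L.+1))%N.
  by move=> <-; rewrite resE addnC (mulnC L.+1) -divn_eq.
have quo_le (m : 'X_{1..p.+1 < n.+1}) : wdeg d m = n -> res m = x ->
    (\sum_j d j * m j %/ L.+1 = q)%N.
  move=> degm mx; apply/eqP; rewrite -(eqn_pmul2l (ltn0Sn L)) big_distrr /=.
  rewrite -(eqn_add2l (\sum_j x j)) -nE -big_split /= -{2}degm; apply/eqP.
  by apply: eq_bigr => j _; rewrite -dmE.
have quoE m j : wdeg d (bmnm m) = n -> res m = x ->
    tnth (quo m) j = (d j * m j %/ L.+1)%N :> nat.
  move=> degm mx; rewrite tnth_mktuple inordK // ltnS -(quo_le m) //.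
  by rewrite (bigD1 j) //= leq_addr.
rewrite -(card_in_imset (f := quo)); last first.
  move=> m1 m2; rewrite !inE => /andP[/eqP deg1 /eqP x1].
  move=> /andP[/eqP deg2 /eqP x2] eq12; apply/val_inj/mnmP => j /=.
  apply/eqP; rewrite -(eqn_pmul2l (d_gt0 j)) (dmE m1) // (dmE m2) //.
  by rewrite -(quoE m1) // -(quoE m2) // eq12.
apply: eq_card => t; rewrite inE; apply/imsetP/eqP => [[m]|sumt].
  rewrite !inE => /andP[/eqP degm /eqP mx] ->.
  rewrite big_tuple -[RHS](quo_le m) //; apply: eq_bigr => j _.
  exact: quoE.
(* The monomial with residues x and quotients t. *)
pose M : 'X_{1..p.+1} := [multinom (x j + L.+1 * tnth t j) %/ d j | j < p.+1]%N.
have dM j : (d j * M j = x j + L.+1 * tnth t j)%N.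
  by rewrite mnmE mulnC divnK // dvdn_add // dvdn_mulr.
have degM : wdeg d M = n.
  rewrite /wdeg nE -sumt big_tuple big_distrr /= -big_split /=.
  by apply: eq_bigr => j _; rewrite dM.
have ltM : (mdeg M < n.+1)%N by rewrite ltnS -degM mdeg_le_wdeg.
have resM : res (BMultinom ltM) = x.
  apply/ffunP=> j; apply: val_inj.
  by rewrite [LHS]resE /= dM addnC mulnC modnMDl modn_small.
exists (BMultinom ltM); first by rewrite !inE /= degM resM !eqxx.
apply: eq_from_tnth => j; apply: ord_inj; rewrite quoE //= dM.
by rewrite addnC mulnC divnMDl // divn_small // addn0.
Qed.

(** * Equidistribution of the classes of the sum *)

(** The periods of a sequence are closed under gcd, by Bezout. *)
Lemma periodic_gcd (T : Type) (I : finType) (J : {set I}) (d : I -> nat)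
    (S : nat -> T) :
  (forall j, j \in J -> forall n, S (n + d j)%N = S n) ->
  forall n, S (n + \big[gcdn/0%N]_(j in J) d j)%N = S n.
Proof.
move=> S_per; pose period a := forall n, S (n + a)%N = S n.
have periodM a c : period a -> period (c * a)%N.
  move=> a_per n; elim: c => [|c IHc]; first by rewrite addn0.
  by rewrite mulSn addnCA addnC a_per.
change (period (\big[gcdn/0%N]_(j in J) d j)).
elim/big_ind: _ => [n|a b a_per b_per n|//]; first by rewrite addn0.
case: (posnP a) => [-> |a_gt0]; first by rewrite gcd0n.
case: (egcdnP b a_gt0) => u v uv _.
by rewrite -(periodM b v b_per) -addnA [(gcdn _ _ + _)%N]addnC -uv periodM.
Qed.

Section WeightBox.
Context (k L : nat) (d : 'I_k -> nat) (d_dvd : forall j, (d j %| L.+1)%N).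
Local Notation D := L.+1.
Local Notation box := (weight_box L d).

Section Equidistribution.
Context (V : nmodType) (w : {ffun 'I_k -> 'I_D} -> V).

(** Adding d_j to the j-th coordinate modulo D permutes the box, preserves w,
    and moves the class of the sum by d_j. *)
Lemma box_class_shift (j : 'I_k) :
  (forall x y : {ffun 'I_k -> 'I_D},
    (forall l, l != j -> x l = y l) -> w x = w y) ->
  forall n, \sum_(x in box | (\sum_l x l == n + d j %[mod D])%N) w x =
            \sum_(x in box | (\sum_l x l == n %[mod D])%N) w x.
Proof.
move=> w_indep n.
pose e : {ffun 'I_k -> 'I_D} := [ffun l => if l == j then inZp (d j) else 0].
have eE (x : {ffun 'I_k -> 'I_D}) l :
      (x + e) l = ((x l + (l == j) * d j) %% D)%N :> nat.
  rewrite !ffunE; case: (l == j); rewrite /= ?mul1n ?modnDmr ?mul0n //.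
have bij_e : bijective (+%R^~ e) by apply: injF_bij; apply: addIr.
rewrite (reindex _ (onW_bij _ bij_e)) /=; apply: eq_big => [x|x _]; last first.
  apply: w_indep => l /negbTE nlj; apply: ord_inj.
  by rewrite eE nlj addn0 modn_small.
congr andb; first rewrite !inE; first (apply: eq_forallb => l; rewrite eE).
  rewrite /dvdn modn_dvdm //; case: (l =P j) => [->|_]; last by rewrite addn0.
  by rewrite mul1n modnDr.
rewrite -[in RHS](eqn_modDr (d j)); congr (_ == _).
under eq_bigr do rewrite eE.
rewrite modn_summ big_split /=; congr ((_ + _) %% _)%N.
by rewrite (bigD1 j) //= eqxx mul1n big1 ?addn0 // => l /negbTE ->.
Qed.

(** The class sums of w are periodic of period d_j for every j in J, hence of
    period 1, so each one is the average of the D classes. *)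
Lemma box_equidistribution (J : {set 'I_k}) :
    weights_gcd d J = 1%N ->
    (forall x y : {ffun 'I_k -> 'I_D},
      (forall l, l \notin J -> x l = y l) -> w x = w y) ->
  forall n, (\sum_(x in box | (\sum_l x l == n %[mod D])%N) w x) *+ D =
            \sum_(x in box) w x.
Proof.
move=> gcdJ w_indep.
pose S n := \sum_(x in box | (\sum_l x l == n %[mod D])%N) w x.
have S1 n : S n.+1 = S n.
  rewrite -addn1 -gcdJ; apply: (@periodic_gcd _ _ J d S) => j jJ m.
  apply: box_class_shift => x y xy; apply: w_indep => l lJ.
  by apply: xy; apply: contraNneq lJ => ->.
have Sc n : S n = S 0%N by elim: n => // n IHn; rewrite S1.
move=> n; rewrite -/(S n) Sc.
pose cls (x : {ffun 'I_k -> 'I_D}) : 'I_D := inZp (\sum_l x l)%N.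
rewrite (partition_big cls predT) //=.
rewrite (eq_bigr (fun=> S 0%N)) ?sumr_const ?card_ord // => r _.
rewrite -(Sc r); apply: eq_bigl => x; congr andb.
by rewrite -val_eqE /= [in RHS](modn_small (ltn_ord r)).
Qed.

End Equidistribution.

(** * Totals over the box *)

Lemma sum_multiples (V : nmodType) (F : nat -> V) (c q : nat) : (0 < c)%N ->
  \sum_(v < q * c | (c %| v)%N) F v = \sum_(r < q) F (r * c)%N.
Proof.
move=> c_gt0; rewrite -!(big_mkord _ (fun v => F v)).
rewrite -(big_mkord predT (fun r => F (r * c)%N)).
elim: q => [|q IHq]; first by rewrite !big_geq.
rewrite big_nat_recr //= -IHq (big_cat_nat (n := (q * c)%N)) //=; last first.
  by rewrite leq_pmul2r.
congr (_ + _).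
rewrite big_ltn_cond; last by rewrite ltn_pmul2r.
rewrite dvdn_mull // big_nat_cond big1 ?addr0 // => v.
move=> /andP[/andP[qv vq] /dvdnP[u uv]]; move: qv vq.
by rewrite uv !ltn_pmul2r // ltnS => /leq_trans h /h; rewrite ltnn.
Qed.

Lemma sum_box_prod (F : 'I_k -> nat -> rat) :
  \sum_(x in box) \prod_l F l (x l) =
    \prod_l \sum_(r < D %/ d l) F l (r * d l)%N.
Proof.
have d_gt0 l : (0 < d l)%N by apply: dvdn_gt0 (d_dvd l).
under [RHS]eq_bigr do rewrite -sum_multiples // divnK //.
rewrite bigA_distr_big_dep; apply: eq_bigl => x; rewrite inE.
by apply/forallP/familyP.
Qed.

Lemma card_box : (#|box|%:R : rat) = \prod_l (D%:R / (d l)%:R).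
Proof.
transitivity (\sum_(x in box) \prod_(l < k) (1 : rat)).
  by under eq_bigr do rewrite big1_eq; rewrite sumr_const.
rewrite (sum_box_prod (fun _ _ => 1)); apply: eq_bigr => l _.
rewrite sumr_const card_ord -[in RHS](divnK (d_dvd l)) natrM mulfK //.
by rewrite Num.Theory.pnatr_eq0 -lt0n (dvdn_gt0 _ (d_dvd l)).
Qed.

(** The j-th coordinate is uniform on the multiples of d_j below D, from 0 to
    D - d_j. *)
Lemma sum_box_coord (j : 'I_k) :
  \sum_(x in box) (x j)%:R = #|box|%:R * (D%:R - (d j)%:R) / 2 :> rat.
Proof.
pose F l v : rat := if l == j then v%:R else 1.
transitivity (\sum_(x in box) \prod_l F l (x l)).
  apply: eq_bigr => x _; rewrite (bigD1 j) //= /F eqxx big1 ?mulr1 //.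
  by move=> l /negbTE ->.
have dj0 : (d j)%:R != 0 :> rat.
  by rewrite Num.Theory.pnatr_eq0 -lt0n (dvdn_gt0 _ (d_dvd j)).
rewrite sum_box_prod card_box (bigD1 j) // [in RHS](bigD1 j) //=.
have -> : \prod_(l | l != j) \sum_(r < D %/ d l) F l (r * d l)%N =
          \prod_(l | l != j) (D%:R / (d l)%:R).
  apply: eq_bigr => l /negbTE lj; under eq_bigr do rewrite /F lj.
  rewrite sumr_const card_ord -[in RHS](divnK (d_dvd l)) natrM mulfK //.
  by rewrite Num.Theory.pnatr_eq0 -lt0n (dvdn_gt0 _ (d_dvd l)).
under eq_bigr do rewrite /F eqxx natrM.
have gauss q : \sum_(r < q) r%:R = q%:R * (q%:R - 1) / 2 :> rat.
  elim: q => [|q IHq]; first by rewrite big_ord0 !mul0r.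
  by rewrite big_ord_recr /= IHq -natr1; field.
rewrite -big_distrl /= gauss; set q := (D %/ d j)%N.
have -> : D%:R = q%:R * (d j)%:R :> rat by rewrite -natrM divnK.
by field.
Qed.

End WeightBox.

(** * The polynomials of the residue vectors *)

(** As a function of n = s + D m, the binomial 'C(p + (n - s) / D, p) is, up to
    its leading coefficient, the product of the n - s + (t + 1) D for t < p. *)
Lemma bin_arith_poly (D p m s : nat) :
  (\prod_(t < p) ('X - (s%:R - (t.+1 * D)%N%:R)%:P)).[(s + D * m)%N%:R] =
    (D ^ p * p`! * 'C(p + m, p))%N%:R :> rat.
Proof.
rewrite horner_prod.
have factor (t : nat) :
    ('X - (s%:R - (t.+1 * D)%N%:R)%:P).[(s + D * m)%N%:R] =
      (D * (m + t.+1))%N%:R :> rat.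
  by rewrite hornerXsubC natrD mulnDr natrD [(t.+1 * D)%N]mulnC; ring.
under eq_bigr do rewrite factor.
elim: p => [|p IHp]; first by rewrite big_ord0 bin0.
rewrite big_ord_recr /= IHp -natrM; congr _%:R.
have pascal := mul_bin_diag (p.+1 + m) p; rewrite /= in pascal.
rewrite factS expnS.
transitivity (D * D ^ p * p`! * ((p.+1 + m) * 'C(p + m, p)))%N; first by ring.
by rewrite pascal; ring.
Qed.

Lemma coef_arith_prod (D r s : nat) :
  (\prod_(t < r.+1) ('X - (s%:R - (t.+1 * D)%N%:R)%:P))`_r =
    D%:R * r.+1%:R * r.+2%:R / 2 - r.+1%:R * s%:R :> rat.
Proof.
pose c (t : 'I_r.+1) : rat := s%:R - (t.+1 * D)%N%:R.
have -> : \prod_(t < r.+1) ('X - (s%:R - (t.+1 * D)%N%:R)%:P) =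
    \prod_(a <- [seq c t | t : 'I_r.+1]) ('X - a%:P).
  by rewrite big_image.
have size_c : size [seq c t | t : 'I_r.+1] = r.+1.
  by rewrite size_map -cardE card_ord.
have := @coefPn_prod_XsubC _ [seq c t | t : 'I_r.+1].
rewrite size_c /= => -> //; rewrite big_image /= /c sumrB sumr_const card_ord.
have gauss q : \sum_(t < q) (t.+1 * D)%N%:R = D%:R * q%:R * q.+1%:R / 2 :> rat.
  elim: q => [|q IHq]; first by rewrite big_ord0 mulr0 !mul0r.
  by rewrite big_ord_recr /= IHq natrM -!natr1; field.
by rewrite gauss opprB; congr (_ - _); rewrite mulr_natl.
Qed.

Lemma poly_eq_on_arith (P Q : {poly rat}) (N i L : nat) :
  (forall t, (N <= t)%N -> P.[(i + L.+1 * t)%N%:R] = Q.[(i + L.+1 * t)%N%:R]) ->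
  P = Q.
Proof.
move=> eqPQ; apply/eqP; rewrite -subr_eq0; apply/eqP.
pose pt t : rat := (i + L.+1 * t)%N%:R.
apply: (@roots_geq_poly_eq0 _ _ [seq pt t | t <- iota N (size (P - Q))]).
- apply/allP => _ /mapP[t + ->]; rewrite mem_iota => /andP[Nt _].
  by rewrite rootE !hornerE eqPQ // subrr.
- rewrite map_inj_uniq ?iota_uniq // => t u /eqP.
  by rewrite Num.Theory.eqr_nat eqn_add2l eqn_pmul2l // => /eqP.
- by rewrite size_map size_iota.
Qed.

(** * The second coefficient *)

Lemma gcd_setC1 (k : nat) (d : 'I_k -> nat) (j : 'I_k) :
  (weights_delta d + 2 <= k)%N -> weights_gcd d [set~ j] = 1%N.
Proof.
move=> delta_le; apply/eqP; apply: contraTT delta_le => gcd_neq1.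
rewrite -ltnNge addn2 ltnS.
apply: leq_trans (leqSpred k) _; rewrite ltnS -[k in k.-1]card_ord -(cardsC1 j).
exact: (@leq_bigmax_cond _ (fun I : {set 'I_k} => weights_gcd d I != 1%N)).
Qed.

Theorem proposition20 (K : fieldType) (k : nat) (d : 'I_k -> nat)
    (d_gt0 : forall i : 'I_k, (0 < d i)%N)
    (d_gcd : weights_gcd d [set: 'I_k] = 1%N)
    (P : (weights_lcm d).-tuple {poly rat})
    (hP : is_hilbert_quasi_polynomial K d_gt0 P)
    (hdelta : (weights_delta d + 2 <= k)%N)
    (i : 'I_(weights_lcm d)) :
  (tnth P i)`_(k - 2) =
    (\sum_(j < k) d j)%N%:R / (2 * (k - 2)`! * \prod_(j < k) d j)%N%:R.
Proof.
have gcd_others j := gcd_setC1 j hdelta.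
case: hP => N hP.
have d_dvd j : (d j %| weights_lcm d)%N by apply: (biglcmn_sup j).
have [L lcmE] : exists L, weights_lcm d = L.+1.
  by exists (weights_lcm d).-1; rewrite prednK // (leq_trans _ (ltn_ord i)).
have [r kE] : exists r, k = r.+2.
  by exists (k - 2)%N; rewrite -addn2 subnK // (leq_trans _ hdelta) ?leq_addl.
have i_lt := ltn_ord i; have := hP _ _ i.
(* The index type of i depends on the lcm: keeping only the value of i allows
   the lcm to be replaced by the successor L.+1. *)
move: (nat_of_ord i) (tnth P i) i_lt => {P hP}i P i_lt {}hP.
rewrite lcmE in d_dvd i_lt hP; subst k; rewrite subSS subSS subn0.
set D := L.+1 in d_dvd i_lt hP *.
pose fibre := [pred x : {ffun 'I_r.+2 -> 'I_D} |
  (x \in weight_box L d) && (\sum_j x j == i %[mod D])%N].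
pose Q (x : {ffun 'I_r.+2 -> 'I_D}) : {poly rat} :=
  \prod_(t < r.+1) ('X - ((\sum_j x j)%N%:R - (t.+1 * D)%N%:R)%:P).
have PE : P = ((D ^ r.+1 * r.+1`!)%N%:R)^-1 *: \sum_(x | fibre x) Q x.
  apply: (@poly_eq_on_arith _ _ (N + r.+2 * D) i L) => t t_large.
  have n_large : (N + r.+2 * D <= i + D * t)%N.
    rewrite (leq_trans t_large) // (leq_trans (leq_pmull t (ltn0Sn L))) //.
    exact: leq_addl.
  rewrite -hP; last first.
  - by rewrite mulnC addnC modnMDl.
  - by apply: leq_trans n_large; rewrite leq_addr.
  rewrite (hilbert_function_box K d_gt0 d_dvd); last first.
    by apply: leq_trans n_large; rewrite leq_addl.
  rewrite hornerZ horner_sum natr_sum big_distrr /=.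
  apply: eq_big => [x|x].
    by rewrite eq_sym [(_ * t)%N]mulnC addnC modnMDl.
  move=> /andP[_ x_n]; set s := (\sum_j x j)%N in x_n *.
  have s_le : (s <= i + D * t)%N.
    by rewrite (leq_trans (sum_ord_le x)) // (leq_trans _ n_large) ?leq_addl.
  have nE : (i + D * t = s + D * ((i + D * t - s) %/ D))%N.
    by rewrite [(D * (_ %/ _))%N]mulnC divnK ?subnKC // -eqn_mod_dvd // eq_sym.
  rewrite [in RHS]nE bin_arith_poly (natrM _ (D ^ _ * _)) mulKf //.
  by rewrite Num.Theory.pnatr_eq0 muln_eq0 expn_eq0 /= -lt0n fact_gt0.
have coefQ x := coef_arith_prod D r (\sum_j x j)%N.
have D_neq0 : D%:R != 0 :> rat by rewrite Num.Theory.pnatr_eq0.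
have d_neq0 j : (d j)%:R != 0 :> rat by rewrite Num.Theory.pnatr_eq0 -lt0n.
have card_fibre : #|fibre|%:R = #|weight_box L d|%:R / D%:R :> rat.
  apply: (canRL (mulfK D_neq0)).
  have := @box_equidistribution _ _ _ d_dvd _ (fun=> 1 : rat) _ d_gcd _ i.
  by rewrite !sumr_const mulr_natr => ->.
have sum_fibre j : \sum_(x | fibre x) (x j)%:R =
    #|weight_box L d|%:R * (D%:R - (d j)%:R) / 2 / D%:R :> rat.
  apply: (canRL (mulfK D_neq0)).
  rewrite mulr_natr -(sum_box_coord d_dvd).
  apply: (@box_equidistribution _ _ _ d_dvd _ _ [set~ j]) => //.
  by move=> x y xy; rewrite xy // !inE eqxx.
rewrite PE coefZ coef_sum; under eq_bigr do rewrite coefQ natr_sum.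
rewrite sumrB sumr_const -big_distrr /= exchange_big /=.
under [X in _ * (_ - _ * X)]eq_bigr do rewrite sum_fibre.
rewrite -!big_distrl -big_distrr /= sumrB sumr_const card_ord.
rewrite -[_ *+ #|_|]mulr_natr card_fibre (card_box d_dvd).
rewrite prodf_div prodr_const card_ord -/D natr_sum natrM factS !natrM natrX.
rewrite natr_prod -(mulr_natr D%:R r.+2).
have prod_neq0 : \prod_j (d j)%:R != 0 :> rat by apply/prodf_neq0.
have fact_neq0 : r`!%:R != 0 :> rat.
  by rewrite Num.Theory.pnatr_eq0 -lt0n fact_gt0.
have r1_neq0 : r.+1%:R != 0 :> rat by rewrite Num.Theory.pnatr_eq0.
have Dr_neq0 : D%:R ^+ r.+1 != 0 :> rat by rewrite expf_neq0.
rewrite [D%:R ^+ r.+2]exprS.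
move: (\prod_j _) (\sum_j _) prod_neq0 => A B A_neq0.
move: (r`!%:R) (r.+1%:R) (r.+2%:R) (D%:R) (D%:R ^+ r.+1) fact_neq0 r1_neq0
  D_neq0 Dr_neq0 => f r1 r2 E Dr f0 r10 E0 Dr0.
by field; rewrite f0 r10 Dr0 E0 A_neq0.
Qed.
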